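(* Let $\alpha>0$ and let $H$ be an infinite-dimensional separable real Hilbert space. Then there exists a continuous strictly convex quadratic function $F:H\to[0,\infty)$ such that $F(u)=0$ if and only if $u=0$ and such that the following is true: for any monotone decreasing function $g:(0,\infty)\to(0,\infty)$ such that \[ \int_0^\infty t\,g(t)\,\mathrm{d}t<\infty, \] there exists a solution $u$ to the heavy ball ODE \[ \ddot u=-\frac{\alpha}{t}\,\dot u-\nabla F(u) \] such that $F(u(t))\ge g(t)$ for all $t\ge 1$.
   Context: A solution of the heavy ball ODE is a curve $u:[0,\infty)\to H$ which is $C^1$ on $[0,\infty)$ and $C^2$ on $(0,\infty)$, satisfies the equation for all $t>0$, and starts from rest: $u(0)=u_0$ for some $u_0\in H$ and $\dot u(0)=0$. $\nabla F$ denotes the gradient with respect to the inner product of $H$. *)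

(* Defs.v *)
From HB Require Import structures.
From mathcomp Require Import all_boot all_order all_algebra.
From mathcomp Require Import all_classical all_reals all_analysis.

Set Implicit Arguments.
Unset Strict Implicit.
Unset Printing Implicit Defensive.

Import Order.TTheory GRing.Theory Num.Theory.
Import numFieldNormedType.Exports.

Local Open Scope classical_set_scope.
Local Open Scope ring_scope.

(* A real Hilbert space is a complete normed space [H] together with an inner
   product [dot : {dot H for idfun}] (symmetric, bilinear, positive definite)
   that induces the norm of [H]. *)
Definition norm_from_dot (R : realType) (H : completeNormedModType R)
    (dot : {dot H for idfun}) : Prop :=
  forall x : H, `|x| ^+ 2 = dot x x.

Definition separable_space (T : topologicalType) : Prop :=
  exists2 S : set T, countable S & dense S.

Definition finite_dimensional (R : realType) (H : lmodType R) : Prop :=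
  exists (n : nat) (b : 'I_n -> H),
    forall x : H, exists c : 'I_n -> R, x = \sum_(i < n) c i *: b i.

Definition quadratic_function (R : realType) (H : lmodType R)
    (F : H -> R) : Prop :=
  exists (B : {symmetric H}) (l : {scalar H}) (c : R),
    forall x : H, F x = B x x + l x + c.

Definition strictly_convex (R : realType) (H : lmodType R)
    (F : H -> R) : Prop :=
  forall (x y : H) (s : R), x != y -> 0 < s < 1 ->
    F (s *: x + (1 - s) *: y) < s * F x + (1 - s) * F y.

(* [w] is the gradient of [F] at [x], i.e. the Riesz representative of the
   Fréchet differential with respect to [dot]. *)
Definition is_gradient (R : realType) (H : completeNormedModType R)
    (dot : {dot H for idfun}) (F : H -> R) (x w : H) : Prop :=
  differentiable F x /\ forall h : H, 'd F x h = dot w h.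

(* Only the restriction of [u] to [0, +oo[ matters; the derivative at 0 is
   one-sided. *)
Definition C1_nonneg (R : realType) (H : normedModType R)
    (u du : R -> H) : Prop :=
  [/\ forall t : R, 0 < t -> is_derive t 1 u (du t),
      (fun h : R => h^-1 *: (u h - u 0)) @ 0^'+ --> du 0 &
      {within `[0, +oo[, continuous du}].

Definition C1_pos (R : realType) (H : normedModType R)
    (v dv : R -> H) : Prop :=
  (forall t : R, 0 < t -> is_derive t 1 v (dv t)) /\
  {in `]0, +oo[, continuous dv}.

Definition heavy_ball_solution (R : realType) (H : completeNormedModType R)
    (dot : {dot H for idfun}) (alpha : R) (F : H -> R) (u : R -> H) : Prop :=
  exists du ddu : R -> H,
    [/\ C1_nonneg u du,
        C1_pos du ddu,
        du 0 = 0 &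
        forall t : R, 0 < t ->
          exists w : H, is_gradient dot F (u t) w /\
            ddu t = - (alpha / t) *: du t - w].

(* Main.v *)
Require Import Defs.
From HB Require Import structures.
From mathcomp Require Import all_boot all_order all_algebra.
From mathcomp Require Import all_classical all_reals all_analysis.
From mathcomp Require Import measurable_realfun ring lra.

Import Order.TTheory GRing.Theory Num.Theory.
Import numFieldNormedType.Exports.

Local Open Scope classical_set_scope.
Local Open Scope ring_scope.

(* Fix an orthonormal sequence e_k, not necessarily total, and let A act on e_k
   as sigma_k^2 = 4^-(k+2) and as the identity on the orthogonal complement of
   the e_k; A is a positive self-adjoint contraction, and F x = <A x, x> / 2.
   The solution started at u_0 at rest is the series sum_n t^n/n! w_n with
   w_0 = u_0, w_1 = 0 and w_{n+2} = - (n+1)/(n+1+alpha) A w_n, which converges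
   since |w_n| <= |u_0|.  Its e_k-coordinate stays above half its initial value
   a_k as long as sigma_k t <= 1/2, so F(u(t)) >= sigma_k^2 a_k^2 / 8 for
   t <= 2^(k+1).  This dominates g(2^k), hence g on [2^k, 2^(k+1)], as soon as
   a_k^2 = 128 4^k g(2^k), and sum_k 4^k g(2^k) < oo because g is monotone and
   t g(t) is integrable. *)

(** * Inner product calculus and orthonormal series *)

Section Hilbert.
Context {R : realType} {H : completeNormedModType R} {dot : {dot H for idfun}}.
Implicit Types (x y z : H) (a b : R).

Definition orthonormal_seq (dot : {dot H for idfun}) (e : nat -> H) : Prop :=
  forall i j, dot (e i) (e j) = (i == j)%:R.

Lemma dotC x y : dot x y = dot y x.
Proof. by rewrite hermC expr0 mul1r. Qed.

Lemma dotDl x y z : dot (x + y) z = dot x z + dot y z.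
Proof. exact: linearDl. Qed.

Lemma dotZl a x y : dot (a *: x) y = a * dot x y.
Proof. exact: linearZl_LR. Qed.

Lemma dotZr a x y : dot x (a *: y) = a * dot x y.
Proof. by rewrite dotC dotZl dotC. Qed.

Lemma dotDr x y z : dot x (y + z) = dot x y + dot x z.
Proof. by rewrite dotC dotDl !(dotC x). Qed.

Lemma dotBl x y z : dot (x - y) z = dot x z - dot y z.
Proof. exact: linearBl. Qed.

Lemma dotBr x y z : dot x (y - z) = dot x y - dot x z.
Proof. by rewrite dotC dotBl !(dotC x). Qed.

Lemma dot_suml (I : Type) (r : seq I) (F : I -> H) y :
  dot (\sum_(i <- r) F i) y = \sum_(i <- r) dot (F i) y.
Proof. exact: linear_sumlz. Qed.

Lemma dot_sumr (I : Type) (r : seq I) (F : I -> H) y :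
  dot y (\sum_(i <- r) F i) = \sum_(i <- r) dot y (F i).
Proof. by rewrite dotC dot_suml; apply: eq_bigr => i _; exact: dotC. Qed.

Hypothesis dotE : norm_from_dot dot.

Lemma dot_ge0 x : 0 <= dot x x.
Proof. by rewrite -dotE exprn_ge0. Qed.

Lemma cauchy_schwarz x y : `|dot x y| <= `|x| * `|y|.
Proof.
rewrite -(@ler_pXn2r _ 2)// ?nnegrE ?mulr_ge0// exprMn !dotE real_normK ?num_real//.
have [->|x0] := eqVneq x 0.
  by rewrite -(scale0r x) !dotZl !mul0r expr0n.
have dx : 0 < dot x x by rewrite -dotE exprn_gt0// normr_gt0.
(* The squared norm of this vector is [dot x x * (dot x x * dot y y - dot x y ^+ 2)]; scaling by
   [dot x x] avoids a division. *)
have := dot_ge0 (dot x x *: y - dot x y *: x).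
rewrite dotBl !dotBr !dotZl !dotZr (dotC y x) => h.
rewrite -(ler_pM2l dx); move: h; lra.
Qed.

Lemma cvg_dotl (T : Type) (F : set_system T) {FF : Filter F} (f : T -> H) x y :
  f @ F --> x -> (fun t => dot (f t) y) @ F --> dot x y.
Proof.
move=> fx.
have : (fun t => `|f t - x| * `|y|) @ F --> 0.
  rewrite -[0](mul0r `|y|); apply: cvgMr_tmp.
  by apply/norm_cvg0P; apply/subr_cvg0.
move=> h; apply/subr_cvg0; apply/norm_cvg0P.
apply: (squeeze_cvgr _ (cvg_cst 0) h).
by apply: nearW => t; rewrite normr_ge0/= -dotBl cauchy_schwarz.
Qed.

Section Orthonormal.
Context (e : nat -> H).
Hypothesis eE : orthonormal_seq dot e.

Lemma dot_sum_orthonormal m n (c d : nat -> R) :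
  dot (\sum_(m <= k < n) c k *: e k) (\sum_(m <= k < n) d k *: e k)
  = \sum_(m <= k < n) c k * d k.
Proof.
rewrite dot_suml big_nat [RHS]big_nat; apply: eq_bigr => k kmn.
rewrite dot_sumr (bigD1_seq k)/= ?mem_index_iota ?iota_uniq//.
rewrite dotZl dotZr eE eqxx mulr1 big1 ?addr0// => i ik.
by rewrite dotZl dotZr eE eq_sym (negbTE ik) !mulr0.
Qed.

(** By orthonormality the squared norm of a block of the series is the matching block of the scalar
    series of squares, so the Cauchy property passes from the scalars to [H], which is complete. *)
Lemma l2_cvg_series (c : nat -> R) M :
  (forall n, \sum_(0 <= k < n) c k ^+ 2 <= M) ->
  cvgn (series (fun k => c k *: e k)).
Proof.
move=> cM.
have : cvgn (series (fun k => c k ^+ 2)).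
  apply: nondecreasing_is_cvgn.
    by apply: nondecreasing_series => k _ _; exact: sqr_ge0.
  by exists M => _ [n _ <-]; exact: cM.
move=> /cauchy_cvgP/cauchy_seriesP sc; apply/cauchy_cvgP/cauchy_seriesP => eps e0.
have := sc _ (exprn_gt0 2 e0); apply: filterS => n h.
rewrite /= in h *; rewrite -(@ltr_pXn2r _ 2)// ?nnegrE ?normr_ge0//; last exact: ltW.
rewrite dotE dot_sum_orthonormal.
by apply: le_lt_trans h; exact: ler_norm.
Qed.

Lemma dot_series_orthonormal (c : nat -> R) y : cvgn (series (fun k => c k *: e k)) ->
  series (fun k => c k * dot (e k) y) @ \oo -->
    dot (limn (series (fun k => c k *: e k))) y.
Proof.
move=> /(cvg_dotl _ _ _ _ y) h; apply: cvg_trans h; apply: near_eq_cvg.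
by apply: nearW => n; rewrite /series/= dot_suml; apply: eq_bigr => k _; rewrite dotZl.
Qed.

Lemma dot_series_coord (c : nat -> R) j : cvgn (series (fun k => c k *: e k)) ->
  dot (limn (series (fun k => c k *: e k))) (e j) = c j.
Proof.
move=> /(dot_series_orthonormal _ (e j)) h; apply/esym.
apply: (cvg_unique _ _ h); first exact: Rhausdorff.
apply: cvg_near_cst; near=> n.
have jn : (j < n)%N by near: n; exact: nbhs_infty_gt.
rewrite /series/= (bigD1_seq j)/= ?mem_index_iota ?iota_uniq//.
rewrite eE eqxx mulr1 big1 ?addr0// => i ij.
by rewrite eE (negbTE ij) mulr0.
Unshelve. all: by end_near. Qed.

Lemma bessel x n : \sum_(0 <= k < n) dot x (e k) ^+ 2 <= dot x x.
Proof.
(* The squared distance from [x] to its projection: both cross terms and the squared norm of the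
   projection equal the same sum, so one copy of it is subtracted from [dot x x]. *)
have := dot_ge0 (x - \sum_(0 <= k < n) dot x (e k) *: e k).
rewrite dotBl !dotBr dot_sum_orthonormal dot_suml dot_sumr.
under eq_bigr do rewrite dotZr -expr2.
under [X in _ - (X - _)]eq_bigr do rewrite dotZl (dotC (e _)) -expr2.
under [X in _ - (_ - X)]eq_bigr do rewrite -expr2.
by rewrite subrr subr0 subr_ge0.
Qed.

End Orthonormal.
End Hilbert.

Lemma cvg_succ {R : numFieldType} {V : normedModType R} (u : nat -> V) (l : V) :
  u @ \oo --> l -> (fun n => u n.+1) @ \oo --> l.
Proof. by move=> ul; rewrite cvg_shiftS. Qed.

(** * Partial sums of exponential generating functions and their first-order remainders *)

Section ExponentialPartialSums.
Context {R : realType} {V : normedModType R}.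
Implicit Types (w : nat -> V) (t h : R).

Definition egf_partial w t : nat -> V :=
  series (fun n => exp_coeff t n *: w n).

(** The first-order Taylor remainder of the monomial of degree [n]. At [n = 0] the truncated
    exponent [n.-1] is harmless because of the factor [n%:R]. *)
Definition taylor_rem t h n : R := (t + h) ^+ n - t ^+ n - h * (n%:R * t ^+ n.-1).

(* As a polynomial in [t] and [h], [taylor_rem t h n] has nonnegative coefficients. *)
Lemma ler_norm_taylor_rem t h n :
  `|taylor_rem t h n| <= taylor_rem `|t| `|h| n.
Proof.
(* The right-hand side contains no subtraction besides the previous remainder, so absolute values
   pass through the induction. *)
have recE (a b : R) m : taylor_rem a b m.+1
    = (a + b) * taylor_rem a b m + b * (b * (m%:R * a ^+ m.-1)).
  rewrite /taylor_rem; case: m => [|m] /=; first by rewrite !expr0; ring.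
  by rewrite !exprS -[m.+2%:R]natr1 -natr1; ring.
elim: n => [|n IHn]; first by rewrite /taylor_rem !expr0 mul0r mulr0 !subrr normr0.
rewrite !recE (le_trans (ler_normD _ _))// !normrM normrX normr_nat lerD2r.
by rewrite ler_pM// ler_normD.
Qed.

(** Differentiating the series shifts [w] and lowers the degree by one, hence [n] terms for the
    derivative against [n.+1] for the function. *)
Lemma egf_partial_rem w t h n :
  egf_partial w (t + h) n.+1 - egf_partial w t n.+1
    - h *: egf_partial (fun k => w k.+1) t n
  = \sum_(0 <= k < n.+1) (taylor_rem t h k / k`!%:R) *: w k.
Proof.
rewrite /egf_partial /series/= scaler_sumr.
have -> : \sum_(0 <= k < n) h *: (exp_coeff t k *: w k.+1) =
    \sum_(0 <= k < n.+1) (h * (k%:R * t ^+ k.-1) / k`!%:R) *: w k.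
  rewrite big_nat_recl//= mul0r mulr0 mul0r scale0r add0r.
  apply: eq_bigr => k _; rewrite scalerA /exp_coeff/= factS natrM; congr (_ *: _).
  have : k`!%:R != 0 :> R by rewrite pnatr_eq0 -lt0n fact_gt0.
  have : k.+1%:R != 0 :> R by rewrite pnatr_eq0.
  by move: (k.+1%:R) (k`!%:R) => a b a0 b0; field; rewrite a0 b0.
rewrite -!sumrB; apply: eq_bigr => k _.
by rewrite -!scalerBl /exp_coeff /taylor_rem/=; congr (_ *: _); ring.
Qed.

End ExponentialPartialSums.

(** * Convergence and term-by-term differentiation of vector-valued exponential series *)

Section ExponentialSeries.
Context {R : realType} {V : completeNormedModType R}.
Implicit Types (w : nat -> V) (t h M : R).

Definition egf w t : V := limn (egf_partial w t).

Lemma cvg_egf w M t :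
  (forall n, `|w n| <= M) -> egf_partial w t @ \oo --> egf w t.
Proof.
move=> wM; apply: normed_cvg.
apply: (@series_le_cvg _ _ (fun n => M *: exp_coeff `|t| n)) => [n|n|n|].
- exact: normr_ge0.
- by rewrite mulr_ge0 ?exp_coeff_ge0 ?(le_trans (normr_ge0 _) (wM 0%N)).
- rewrite /= normrZ mulrC ler_pM//.
  by rewrite /exp_coeff/= normrM normfV normrX normr_nat.
- exact: is_cvg_seriesZ (is_cvg_series_exp_coeff _).
Qed.

Lemma expR_sub1_le (x : R) : 0 <= x <= 1 / 2 -> expR x - 1 - x <= 2 * x ^+ 2.
Proof.
move=> /andP[x0 x1].
(* Inverting [1 - x <= expR (- x)] bounds [expR x] by the geometric sum [(1 - x)^-1], which is
   elementary to compare for [x <= 1 / 2]. *)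
have := expR_ge1Dx (- x); rewrite expRN => e1.
have e2 : expR x <= (1 - x)^-1.
  by rewrite -[expR x]invrK lef_pV2 ?qualifE/= ?invr_gt0 ?expR_gt0//; lra.
have : (1 - x)^-1 <= 1 + x + 2 * x ^+ 2.
  by rewrite -[(1 - x)^-1]mul1r ler_pdivrMr; nra.
by lra.
Qed.

(** The bound is [M] times the same remainder for the scalar exponential, taken at the absolute
    values of [t] and [h]; the two are compared term by term before passing to the limit. *)
Lemma egf_rem w M t h : (forall n, `|w n| <= M) ->
  `|egf w (t + h) - egf w t - h *: egf (fun n => w n.+1) t| <=
    M * (expR `|t| * (expR `|h| - 1 - `|h|)).
Proof.
move=> wM; have M0 : 0 <= M := le_trans (normr_ge0 _) (wM 0%N).
pose r n : V := egf_partial w (t + h) n.+1 - egf_partial w t n.+1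
    - h *: egf_partial (fun k => w k.+1) t n.
have r_cvg : r @ \oo --> egf w (t + h) - egf w t - h *: egf (fun n => w n.+1) t.
  apply: cvgB; last by apply: cvgZl_tmp; exact: cvg_egf (fun n => wM n.+1).
  by apply: cvgB; apply: cvg_succ; exact: cvg_egf wM.
pose ex x : nat -> R := series (exp_coeff x).
have ex_cvg x : ex x @ \oo --> expR x by exact: is_cvg_series_exp_coeff.
pose s n : R := M * (ex (`|t| + `|h|) n.+1 - ex `|t| n.+1 - `|h| * ex `|t| n).
have s_cvg : s @ \oo --> M * (expR `|t| * (expR `|h| - 1 - `|h|)).
  have -> : M * (expR `|t| * (expR `|h| - 1 - `|h|)) =
      M * (expR (`|t| + `|h|) - expR `|t| - `|h| * expR `|t|).
    by rewrite expRD; ring.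
  apply: cvgMl_tmp; apply: cvgB; last by apply: cvgMl_tmp; exact: ex_cvg.
  by apply: cvgB; apply: cvg_succ; exact: ex_cvg.
apply: (ler_cvg_to (cvg_norm r_cvg) s_cvg).
apply: nearW => n; rewrite /r /s egf_partial_rem.
(* The real exponential is the case of the constant sequence 1, so [egf_partial_rem] expands the
   majorant too. *)
have exE x m : ex x m = @egf_partial R R^o (fun _ => 1) x m.
  by apply: eq_bigr => k _; rewrite /= -[LHS]mulr1.
rewrite !exE [X in M * X](@egf_partial_rem R R^o (fun _ => 1)) mulr_sumr.
apply: (le_trans (ler_norm_sum _ _ _)); apply: ler_sum => k _.
rewrite normrZ -[_ *: 1]/(_ * 1) mulr1 mulrC ler_pM// normrM normfV normr_nat.
by rewrite ler_wpM2r ?invr_ge0// ler_norm_taylor_rem.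
Qed.

(** The remainder bound of [egf_rem] is quadratic in [h], so it vanishes after division by [h]. *)
Lemma is_derive_egf w M t : (forall n, `|w n| <= M) ->
  is_derive t 1 (egf w) (egf (fun n => w n.+1) t).
Proof.
move=> wM; have M0 : 0 <= M := le_trans (normr_ge0 _) (wM 0%N).
set l := egf _ t.
suff H : (fun h : R => h^-1 *: (egf w (h *: 1 + t) - egf w t)) @ 0^' --> l.
  by apply: DeriveDef; [apply/cvg_ex; exists l|exact: (cvg_lim _ H)].
(* The added 1 keeps this constant, later a divisor, positive even when [M = 0]. *)
have A0 : 0 < M * expR `|t| * 2 + 1.
  by rewrite ltr_wpDl// !mulr_ge0 ?expR_ge0.
apply/cvgrPdist_le => e e0; near=> h.
have h0 : h != 0 by near: h; exact: nbhs_dnbhs_neq.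
rewrite -normrN opprB -[X in _ - X](scalerK h0) -scalerBr normrZ normfV.
rewrite ler_pdivrMl ?normr_gt0// [h *: 1]mulr1 [h + t]addrC.
apply: (le_trans (egf_rem _ _ _ _ wM)).
have hh : `|h| <= 1 / 2.
  near: h; apply: (@dnbhs0_le _ R^o) => //.
apply: (@le_trans _ _ (M * (expR `|t| * (2 * `|h| ^+ 2)))).
  by rewrite ler_wpM2l// ler_wpM2l ?expR_ge0// expR_sub1_le// normr_ge0.
rewrite (_ : M * _ = `|h| * ((M * expR `|t| * 2) * `|h|)); last by ring.
rewrite ler_wpM2l//.
apply: (@le_trans _ _ ((M * expR `|t| * 2 + 1) * `|h|)).
  by rewrite ler_wpM2r// lerDl.
rewrite mulrC -ler_pdivlMr//.
by near: h; apply: dnbhs0_le; exact: divr_gt0.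
Unshelve. all: by end_near. Qed.

Lemma continuous_egf w M : (forall n, `|w n| <= M) -> continuous (egf w).
Proof.
move=> wM t; apply: differentiable_continuous; apply/derivable1_diffP.
by have [] := is_derive_egf w M t wM.
Qed.

Lemma egf0 w : egf w 0 = w 0%N.
Proof.
apply: lim_near_cst => //; near=> n.
rewrite -[n]prednK; last by near: n; exact: nbhs_infty_gt.
rewrite /egf_partial /series/= big_nat_recl//= {1}/exp_coeff/= expr0 fact0 divr1.
rewrite scale1r big1 ?addr0// => i _.
by rewrite /exp_coeff/= expr0n mul0r scale0r.
Unshelve. all: by end_near. Qed.

End ExponentialSeries.

(** * Dyadic sums controlled by the integral of [t * g t] *)

Section DyadicSums.
Context {R : realType} (g : R -> R).
Hypothesis g_gt0 : forall t : R, 0 < t -> 0 < g t.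
Hypothesis g_decr : forall s t : R, 0 < s -> s <= t -> g t <= g s.

Local Notation mu := (@lebesgue_measure R).

(** Superlevel sets of a monotone function are intervals. *)
Lemma measurable_nonincreasing_pos : measurable_fun (`]0, +oo[%classic : set R) g.
Proof.
apply: (measurability (@RGenCInfty.G R)) => [|_ [_] [r] -> <-].
  exact: RGenCInfty.measurableE.
apply: is_interval_measurable => s t/=; rewrite !in_itv/= !andbT.
move=> [s0 gs] [t0 gt] u /andP[su ut]; have u0 := lt_le_trans s0 su.
by rewrite !in_itv/= !andbT u0 (le_trans gt)// g_decr.
Qed.

Lemma measurable_mul_id_pos :
  measurable_fun (`]0, +oo[%classic : set R) (fun t => (t * g t)%:E).
Proof.
apply/measurable_EFinP; apply: measurable_funM; last exact: measurable_nonincreasing_pos.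
exact: measurable_id.
Qed.

(** On this interval of length [a], monotonicity bounds the integrand below by the constant
    [a * g (2 * a)]. *)
Lemma dyadic_block_le (a : R) : 0 < a ->
  ((a ^+ 2 * g (2 * a))%:E <= \int[mu]_(t in `]a, (2 * a)%R]) (t * g t)%:E)%E.
Proof.
move=> a0.
have sub : `]a, (2 * a)%R] `<=` (`]0, +oo[%classic : set R).
  by move=> t/=; rewrite !in_itv/= andbT => /andP[/(lt_trans a0)].
have -> : (a ^+ 2 * g (2 * a))%:E = (\int[mu]_(t in `]a, (2 * a)%R]) (a * g (2 * a))%:E)%E.
  rewrite integral_cst//= lebesgue_measure_itv/= lte_fin ifT; last by lra.
  by rewrite -EFinD -EFinM; congr _%:E; ring.
apply: ge0_le_integral => //=.
- by move=> t _; rewrite lee_fin mulr_ge0// ltW// g_gt0//; lra.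
- by apply: measurable_funS measurable_mul_id_pos.
move=> t; rewrite in_itv/= => /andP[at_ t2].
have t0 : 0 < t by lra.
rewrite lee_fin ler_pM ?(ltW a0) ?(ltW at_) ?g_decr//.
by rewrite ltW// g_gt0//; lra.
Qed.

(** The block belonging to [k] runs from [2 ^+ k / 2] to [2 ^+ k], so that [g] is sampled at its
    right end; these blocks are disjoint. *)
Lemma dyadic_sum_le n :
  ((\sum_(0 <= k < n) (2 ^+ k / 2) ^+ 2 * g (2 ^+ k))%:E <=
   \int[mu]_(t in `]0%R, (2 ^+ n / 2)%R]) (t * g t)%:E)%E.
Proof.
elim: n => [|n IHn].
  rewrite big_nil; apply: integral_ge0 => t/=; rewrite in_itv/= => /andP[t0 _].
  by rewrite lee_fin mulr_ge0// ltW// g_gt0.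
have p0 : 0 < 2 ^+ n :> R by rewrite exprn_gt0.
rewrite big_nat_recr//= EFinD.
have -> : `]0, (2 ^+ n.+1 / 2)]%classic =
    `]0, (2 ^+ n / 2)]%classic `|` `](2 ^+ n / 2), (2 ^+ n.+1 / 2)]%classic :> set R.
  rewrite -itv_bndbnd_setU// bnd_simp; first by lra.
  by rewrite exprS; lra.
rewrite ge0_integral_setU//=; first last.
- rewrite disj_set2E; apply/eqP; rewrite -subset0 => t/=; rewrite !in_itv/=.
  by move=> [/andP[_ h1] /andP[h2 _]]; move: (lt_le_trans h2 h1); rewrite ltxx.
- move=> t [|]/=; rewrite in_itv/= => /andP[h _];
    by rewrite lee_fin mulr_ge0// ltW ?g_gt0//; lra.
- apply: measurable_funS measurable_mul_id_pos => //.
  by move=> t [|]/=; rewrite !in_itv/= andbT => /andP[h _]; lra.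
apply: leeD => //; have := dyadic_block_le (2 ^+ n / 2).
have -> : 2 ^+ n.+1 / 2 = 2 ^+ n :> R by rewrite exprS; field.
by rewrite [2 * (_ / 2)]mulrC divfK//; apply; rewrite divr_gt0.
Qed.

Lemma dyadic_sum_bounded :
  (\int[mu]_(t in (`]0%R, +oo[%classic : set R)) (t * g t)%:E < +oo)%E ->
  exists M, forall n, \sum_(0 <= k < n) 4 ^+ k * g (2 ^+ k) <= M.
Proof.
set I := (X in (X < _)%E) => Ioo.
have I0 : (0 <= I)%E.
  apply: integral_ge0 => t/=; rewrite in_itv/= andbT => t0.
  by rewrite lee_fin mulr_ge0// ltW// g_gt0.
(* The factor 4 undoes the halving in [(2 ^+ k / 2) ^+ 2]. *)
exists (4 * fine I) => n.
have -> : \sum_(0 <= k < n) 4 ^+ k * g (2 ^+ k) =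
    4 * \sum_(0 <= k < n) (2 ^+ k / 2) ^+ 2 * g (2 ^+ k).
  rewrite mulr_sumr; apply: eq_bigr => k _.
  have -> : 4 ^+ k = (2 ^+ k) ^+ 2 :> R.
    by rewrite exprAC; congr (_ ^+ _); ring.
  by field.
rewrite ler_pM2l// -lee_fin fineK ?ge0_fin_numE//.
apply: (le_trans (dyadic_sum_le n)); apply: ge0_subset_integral => //=.
- exact: measurable_mul_id_pos.
- by move=> t/=; rewrite in_itv/= andbT => t0; rewrite lee_fin mulr_ge0// ltW// g_gt0.
- by move=> t/=; rewrite !in_itv/= andbT => /andP[].
Qed.

End DyadicSums.

(** * An orthonormal sequence in infinite dimension, by Gram-Schmidt *)

Section OrthonormalSequence.
Context {R : realType} {H : completeNormedModType R} {dot : {dot H for idfun}}.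

Definition orthonormal_set (s : seq H) : Prop :=
  uniq s /\ {in s &, forall x y, dot x y = (x == y)%:R}.

(** If there were no such [v], every [x] would equal its projection onto the span of [s], since a
    nonzero residual could be normalized; then [s] would span [H]. *)
Lemma orthonormal_set_extend (s : seq H) :
  ~ finite_dimensional H -> orthonormal_set s ->
  exists v, dot v v = 1 /\ {in s, forall y, dot v y = 0}.
Proof.
move=> Hinf [us os]; apply: contrapT => no_v; apply: Hinf.
exists (size s), (fun i => s`_i) => x; exists (fun i => dot x s`_i).
rewrite -(big_mkord xpredT (fun i => dot x s`_i *: s`_i)).
rewrite -(big_nth 0 xpredT (fun y => dot x y *: y)).
apply/eqP; rewrite -subr_eq0; apply/negPn/negP; set z := _ - _ => z0; apply: no_v.
have zs : {in s, forall y, dot z y = 0}.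
  move=> y ys; rewrite dotBl dot_suml (bigD1_seq y)//= dotZl os// eqxx mulr1.
  rewrite big_seq_cond big1 ?addr0 ?subrr// => i /andP[is_ iy].
  by rewrite dotZl os// (negbTE iy) mulr0.
have zz : 0 < dot z z by exact: neq0_dnorm_gt0.
exists ((Num.sqrt (dot z z))^-1 *: z); split.
  rewrite dotZl dotZr mulrA -invfM -expr2 sqr_sqrtr; last exact: ltW.
  by rewrite mulVf// gt_eqF.
by move=> y ys; rewrite dotZl (zs y ys) mulr0.
Qed.

Lemma exists_orthonormal_seq :
  ~ finite_dimensional H -> exists e, orthonormal_seq dot e.
Proof.
move=> Hinf.
have /choice[next nextP] : forall s, exists v, orthonormal_set s ->
    dot v v = 1 /\ {in s, forall y, dot v y = 0}.
  (* The default 0 on lists that are not orthonormal makes [next] a total function. *)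
  move=> s; have [os|nos] := pselect (orthonormal_set s); last by exists 0.
  by have [v vP] := orthonormal_set_extend _ Hinf os; exists v.
(* [L n] lists the first [n] vectors of the sequence, the latest at the head. *)
pose L := fix L n := if n is m.+1 then next (L m) :: L m else [::].
have oL n : orthonormal_set (L n).
  elim: n => [|n IHn]; first by split.
  have [v1 v0] := nextP _ IHn; have [un on] := IHn.
  have vn : next (L n) \notin L n.
    by apply/negP => /v0; rewrite v1 => /eqP; rewrite oner_eq0.
  have neq y : y \in L n -> (next (L n) == y) = false.
    by move=> yn; apply/eqP => vy; move: vn; rewrite vy yn.
  split=> [|x y]; first by rewrite /= vn.
  rewrite !inE => /predU1P[->|xn] /predU1P[->|yn].
  - by rewrite v1 eqxx.
  - by rewrite v0// neq.
  - by rewrite dotC v0// eq_sym neq.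
  - exact: on.
have eL i j : (i < j)%N -> next (L i) \in L j.
  elim: j => // j IHj; rewrite ltnS leq_eqVlt => /predU1P[->|/IHj ij].
    by rewrite inE eqxx.
  by rewrite inE ij orbT.
exists (fun n => next (L n)) => i j; case: (ltngtP i j) => [ij|ji|->].
- by rewrite dotC; have [_] := nextP _ (oL j); apply; exact: eL.
- by have [_] := nextP _ (oL i); apply; exact: eL.
- by have [] := nextP _ (oL j).
Qed.

End OrthonormalSequence.

(** * A positive diagonal contraction *)

Section DiagonalOperator.
Context {R : realType} {H : completeNormedModType R} {dot : {dot H for idfun}}.
Hypothesis dotE : norm_from_dot dot.
Context (e : nat -> H).
Hypothesis eE : orthonormal_seq dot e.
Context (lam : nat -> R).
Hypothesis lam01 : forall k, 0 < lam k <= 1.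
Implicit Types (x y : H).

Let defect x : nat -> H := series (fun k => ((1 - lam k) * dot x (e k)) *: e k).

(* Acts as [lam k] on [e k] and as the identity on the orthogonal complement of
   the [e k], so that it is injective without [e] being total. *)
Definition diag_op x : H := x - limn (defect x).

(** The factors [1 - lam k] lie between 0 and 1, so Bessel's inequality makes the coefficients
    square-summable. *)
Let cvg_defect x : defect x @ \oo --> limn (defect x).
Proof.
apply: (l2_cvg_series dotE _ eE _ (dot x x)) => n.
apply: le_trans (bessel dotE _ eE x n); apply: ler_sum => k _.
have /andP[l0 l1] := lam01 k.
by rewrite exprMn ler_piMl ?sqr_ge0// expr_le1//; lra.
Qed.

Let cvg_diag_op x : (fun n => x - defect x n) @ \oo --> diag_op x.
Proof. by apply: cvgB; [exact: cvg_cst|exact: cvg_defect]. Qed.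

Let dot_diag_op x y :
  (fun n => dot x y - \sum_(0 <= k < n) (1 - lam k) * dot x (e k) * dot y (e k))
    @ \oo --> dot (diag_op x) y.
Proof.
rewrite (_ : (fun n => _) = (fun n => dot (x - defect x n) y)); last first.
  apply/funext => n.
  rewrite dotBl /defect /series/= dot_suml; congr (_ - _); apply: eq_bigr => k _.
  by rewrite dotZl (dotC (e k)).
exact: (cvg_dotl dotE _ _ _ _ _ (cvg_diag_op x)).
Qed.

Lemma diag_op_linear : linear diag_op.
Proof.
move=> a x y; have := cvg_diag_op (a *: x + y).
rewrite (_ : (fun n => _) =
    fun n => a *: (x - defect x n) + (y - defect y n)); last first.
  apply/funext => n; rewrite scalerBr addrACA -opprD; congr (_ - _).
  rewrite scaler_sumr -big_split/=; apply: eq_bigr => k _.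
  by rewrite scalerA -scalerDl dotDl dotZl; congr (_ *: _); ring.
move=> h; apply: (cvg_unique _ h); first exact: norm_hausdorff.
by apply: cvgD; [apply: cvgZl_tmp; exact: cvg_diag_op|exact: cvg_diag_op].
Qed.

Lemma diag_op_sym x y : dot (diag_op x) y = dot x (diag_op y).
Proof.
rewrite [RHS]dotC; apply: (cvg_unique (@Rhausdorff R) (dot_diag_op _ _)).
rewrite (_ : (fun n => _) = (fun n => dot y x - \sum_(0 <= k < n)
    (1 - lam k) * dot y (e k) * dot x (e k))); first exact: dot_diag_op.
by apply/funext => n; rewrite dotC; congr (_ - _); apply: eq_bigr => k _; ring.
Qed.

Lemma diag_op_coord x k : dot (diag_op x) (e k) = lam k * dot x (e k).
Proof.
rewrite dotBl (dot_series_coord dotE _ eE); last exact: cvg_defect.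
by ring.
Qed.

(** The squared norm of [x - defect x n] is [dot x x - 2 * S + T], where [S] and [T] weight the
    squared coordinates by [1 - lam k] and by its square; hence [0 <= T <= S]. *)
Lemma diag_op_contract x : `|diag_op x| <= `|x|.
Proof.
apply: (ler_cvg_to (cvg_norm (cvg_diag_op x)) (cvg_cst `|x|)).
apply: nearW => n; rewrite -(@ler_pXn2r _ 2)// ?nnegrE ?normr_ge0// !dotE.
rewrite dotBl !dotBr (dot_sum_orthonormal _ eE) dot_suml dot_sumr.
rewrite (eq_bigr (fun k => (1 - lam k) * dot x (e k) ^+ 2)); last first.
  by move=> k _; rewrite dotZr; ring.
rewrite [X in _ - (X - _)](eq_bigr (fun k => (1 - lam k) * dot x (e k) ^+ 2)); last first.
  by move=> k _; rewrite dotZl (dotC (e k)); ring.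
set S := \sum_(_ <= _ < _) _; set T := \sum_(_ <= _ < _) _.
have ST : T <= S.
  apply: ler_sum => k _; have /andP[l0 l1] := lam01 k.
  rewrite -expr2 exprMn ler_wpM2r ?sqr_ge0// expr2 ler_piMl//; lra.
have T0 : 0 <= T by apply: sumr_ge0 => k _; rewrite -expr2 sqr_ge0.
by lra.
Qed.

(** Bessel bounds [dot x x] below by the sum of squared coordinates; removing the defect leaves the
    sum of [lam i * dot x (e i) ^+ 2], which dominates its term at [k]. *)
Lemma diag_op_form_ge x k : lam k * dot x (e k) ^+ 2 <= dot (diag_op x) x.
Proof.
apply: (ler_cvg_to (cvg_cst _) (dot_diag_op x x)); near=> n.
have kn : (k < n)%N by near: n; exact: nbhs_infty_gt.
rewrite lerBrDr; apply: le_trans (bessel dotE _ eE x n).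
rewrite [leRHS](eq_bigr (fun i => lam i * dot x (e i) ^+ 2
  + (1 - lam i) * dot x (e i) * dot x (e i))); last by move=> i _; ring.
rewrite big_split/= lerD2r (bigD1_seq k)/= ?mem_index_iota ?iota_uniq//.
rewrite lerDl sumr_ge0// => i _; have /andP[l0 _] := lam01 i.
by rewrite mulr_ge0 ?sqr_ge0// ltW.
Unshelve. all: by end_near. Qed.

(** A nonpositive value would force every coordinate to vanish; then the operator fixes [x] and the
    form equals [dot x x], which is positive. *)
Lemma diag_op_form_gt0 x : x != 0 -> 0 < dot (diag_op x) x.
Proof.
move=> x0; rewrite ltNge; apply/negP => Ax.
have xk k : dot x (e k) = 0.
  have /andP[l0 _] := lam01 k; apply/eqP; rewrite -sqrf_eq0.
  rewrite -(mulrI_eq0 _ (lregP (lt0r_neq0 l0))).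
  rewrite eq_le (le_trans (diag_op_form_ge x k) Ax)/=.
  by rewrite mulr_ge0 ?sqr_ge0// ltW.
have Ax_x : diag_op x = x.
  rewrite /diag_op (_ : defect x = fun=> 0) ?lim_cst ?subr0//; last first.
  by apply/funext => n; rewrite /defect /series/= big1// => k _; rewrite xk mulr0 scale0r.
by move: Ax; rewrite Ax_x leNgt neq0_dnorm_gt0.
Qed.

End DiagonalOperator.

(** * The quadratic energy: convexity and gradient *)

Section QuadraticEnergy.
Context {R : realType} {H : completeNormedModType R} {dot : {dot H for idfun}}.
Hypothesis dotE : norm_from_dot dot.
Context (A : {linear H -> H}).
Hypothesis A_sym : forall x y : H, dot (A x) y = dot x (A y).
Hypothesis A_contract : forall x : H, `|A x| <= `|x|.
Hypothesis A_gt0 : forall x : H, x != 0 -> 0 < dot (A x) x.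

Definition energy (x : H) : R := dot (A x) x / 2.

Lemma energyD x h : energy (x + h) = energy x + dot (A x) h + energy h.
Proof.
rewrite /energy (linearD A) !dotDl !dotDr [dot (A h) x]dotC -A_sym.
by field.
Qed.

Lemma energyZ a x : energy (a *: x) = a ^+ 2 * energy x.
Proof. by rewrite /energy (linearZ_LR A) dotZl dotZr expr2 !mulrA. Qed.

Lemma energy_gt0 x : x != 0 -> 0 < energy x.
Proof. by move=> x0; rewrite divr_gt0// A_gt0. Qed.

Lemma energy_ge0 x : 0 <= energy x.
Proof.
have [->|/energy_gt0/ltW//] := eqVneq x 0.
by rewrite /energy -(scale0r (0 : H)) (linearZ_LR A) dotZl !mul0r.
Qed.

Lemma energy_eq0 x : energy x = 0 <-> x = 0.
Proof.
split=> [ex|->]; last by rewrite -(scale0r (0 : H)) energyZ expr0n mul0r.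
by apply/eqP/negPn/negP => /energy_gt0; rewrite ex ltxx.
Qed.

Lemma norm_energy_le x : `|energy x| <= `|x| ^+ 2.
Proof.
rewrite normrM (ger0_norm (_ : 0 <= 2^-1)) ?invr_ge0// ler_pdivrMr//.
rewrite (le_trans (cauchy_schwarz dotE _ _))// expr2.
have := ler_wpM2r (normr_ge0 x) (A_contract x); have := sqr_ge0 `|x|; nra.
Qed.

(** The convexity gap is exactly [s * (1 - s) * energy (x - y)]. *)
Lemma energy_strictly_convex : strictly_convex energy.
Proof.
move=> x y s xy /andP[s0 s1].
have d0 : 0 < energy (x - y) by rewrite energy_gt0// subr_eq0.
have -> : s *: x + (1 - s) *: y = y + s *: (x - y).
  by rewrite scalerBl scale1r scalerBr addrCA addrC.
have xE : energy x = energy (y + (x - y)) by rewrite addrC subrK.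
rewrite xE; move: d0; set d := x - y => d0.
rewrite !(energyD y) energyZ dotZr -subr_gt0.
rewrite [X in 0 < X](_ : _ = s * (1 - s) * energy d); last by ring.
by rewrite mulr_gt0 ?d0// mulr_gt0// subr_gt0.
Qed.

Definition energy_form (x y : H) : R := dot (A x) y / 2.

Fact energy_form_bilinear : bilinear_for
  (GRing.Scale.Law.clone _ _ *%R _) (GRing.Scale.Law.clone _ _ *%R _) energy_form.
Proof.
split=> [y a x z|x a y z]; rewrite /energy_form/=.
  by rewrite (linearP A) dotDl dotZl mulrDl mulrA.
by rewrite dotDr dotZr mulrDl mulrA.
Qed.

HB.instance Definition _ := bilinear_isBilinear.Build R H H R
  *%R (GRing.Scale.Law.clone _ _ *%R _) energy_form energy_form_bilinear.

Fact energy_form_sym (x y : H) :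
  energy_form x y = (-1) ^+ false * idfun (energy_form y x).
Proof. by rewrite expr0 mul1r /energy_form dotC A_sym. Qed.

HB.instance Definition _ :=
  isHermitianSesquilinear.Build R H false idfun energy_form energy_form_sym.

Lemma energy_quadratic : quadratic_function energy.
Proof.
exists energy_form, (\0 : {scalar H}), 0 => x.
by rewrite !addr0.
Qed.

Lemma energy_gradient x : is_gradient dot energy x (A x).
Proof.
have cdot : continuous (dot (A x) : H -> R).
  move=> y; rewrite /continuous_at dotC (_ : dot (A x) = fun z => dot z (A x)).
    by apply: cvg_dotl => //; exact: cvg_id.
  by apply/funext => z; exact: dotC.
have expansion : energy \o shift x = cst (energy x) + dot (A x) +o_ 0 id.
  (* By [energyD] the remainder is exactly [energy h], of quadratic size in [h]. *)
  apply/eqaddoP => eps eps0; move: (@nbhs0_le _ H _ eps0); apply: filterS => h heps.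
  rewrite -[X in `|X| <= _]/(energy (h + x) - (energy x + dot (A x) h)).
  rewrite [h + x]addrC energyD addrAC subrr add0r.
  by apply: (le_trans (norm_energy_le h)); rewrite expr2 ler_wpM2r//=.
have dE := diff_unique cdot expansion.
split; last by move=> h; rewrite dE.
by apply/diff_locallyP; rewrite dE.
Qed.

Lemma energy_continuous : continuous energy.
Proof. by move=> x; apply: differentiable_continuous; have [] := energy_gradient x. Qed.

End QuadraticEnergy.

(** * The power series solution and a lower bound on its coordinates *)

Section HeavyBallSeries.
Context {R : realType} {H : completeNormedModType R} {dot : {dot H for idfun}}.
Hypothesis dotE : norm_from_dot dot.
Context (A : {linear H -> H}).
Hypothesis A_contract : forall x : H, `|A x| <= `|x|.
Context (alpha : R).
Hypothesis alpha_gt0 : 0 < alpha.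
Context (u0 : H).

Definition damping_ratio (n : nat) : R := n.+1%:R / (n.+1%:R + alpha).

(* The recurrence is what [t u'' + alpha u' + t A u = 0] imposes on the Taylor
   coefficients [u^(n)(0)]. *)
Fixpoint hb_coeff (n : nat) : H :=
  match n with
  | 0%N => u0
  | 1%N => 0
  | (m.+1 as k).+1 => - damping_ratio m *: A (hb_coeff m)
  end.

Lemma hb_coeffSS n : hb_coeff n.+2 = - damping_ratio n *: A (hb_coeff n).
Proof. by []. Qed.

Lemma damping_ratio_itv n : 0 <= damping_ratio n <= 1.
Proof.
have n0 : 0 < n.+1%:R + alpha by rewrite addr_gt0.
by rewrite divr_ge0 ?(ltW n0)// ler_pdivrMr// mul1r lerDl ltW.
Qed.

Lemma hb_coeff_bounded n : `|hb_coeff n| <= `|u0|.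
Proof.
(* The recurrence reaches back two steps, so the induction carries consecutive pairs. *)
suff: `|hb_coeff n| <= `|u0| /\ `|hb_coeff n.+1| <= `|u0| by case.
elim: n => [|n [IHn IHn1]]; first by rewrite /= normr0 normr_ge0.
split=> //; rewrite hb_coeffSS normrZ normrN.
have /andP[d0 d1] := damping_ratio_itv n; rewrite ger0_norm//.
by rewrite (le_trans (ler_piMl _ d1))// (le_trans (A_contract _)).
Qed.

Lemma egf_op w M t : (forall n, `|w n| <= M) ->
  egf (fun n => A (w n)) t = A (egf w t).
Proof.
move=> wM; have AwM n : `|A (w n)| <= M := le_trans (A_contract _) (wM n).
have h1 := cvg_egf _ _ t AwM; apply: (cvg_unique _ h1); first exact: norm_hausdorff.
have h : (fun n => A (egf_partial w t n)) @ \oo --> A (egf w t).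
  apply/cvgrPdist_le => eps eps0.
  have /cvgrPdist_le/(_ _ eps0) := cvg_egf _ _ t wM; apply: filterS => n.
  by apply: le_trans; rewrite -(linearB A); exact: A_contract.
rewrite (_ : egf_partial _ t = fun n => A (egf_partial w t n))//.
apply/funext => n; rewrite /egf_partial /series/= (linear_sum A).
by apply: eq_bigr => k _; rewrite linearZ_LR.
Qed.

Lemma hb_series_ode t : 0 < t ->
  egf (fun n => hb_coeff n.+2) t =
  - (alpha / t) *: egf (fun n => hb_coeff n.+1) t - A (egf hb_coeff t).
Proof.
move=> t0; have tn0 : t != 0 by rewrite gt_eqF.
rewrite -(egf_op _ _ _ hb_coeff_bounded).
(* Multiplying by [t] turns the equation into [t (u'' + A u) = - alpha u'], which has no singular
   coefficient. *)
apply: (scalerI tn0); rewrite scalerBr scalerA mulrN mulrCA divff// mulr1.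
apply/eqP; rewrite eq_sym subr_eq eq_sym -scalerDr; apply/eqP.
have c2 := cvg_egf _ _ t (fun n => hb_coeff_bounded n.+2).
have c1 := cvg_egf _ _ t (fun n => hb_coeff_bounded n.+1).
have cA := cvg_egf (fun n => A (hb_coeff n)) _ t
  (fun n => le_trans (A_contract _) (hb_coeff_bounded n)).
have h1 : (fun n => t *: (egf_partial (fun n => hb_coeff n.+2) t n +
    egf_partial (fun n => A (hb_coeff n)) t n)) @ \oo -->
    t *: (egf (fun n => hb_coeff n.+2) t + egf (fun n => A (hb_coeff n)) t).
  by apply: cvgZl_tmp; exact: cvgD.
apply: (cvg_unique _ h1); first exact: norm_hausdorff.
(* Multiplication by [t] shifts degrees by one, so [n] terms on the left match [n.+1] on the right,
   whose first term is zero because [hb_coeff 1] is. The other terms agree since [1 - damping_ratio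
   k = alpha * damping_ratio k / k.+1]. *)
rewrite (_ : (fun n => _) =
  fun n => - alpha *: egf_partial (fun n => hb_coeff n.+1) t n.+1).
  by apply: cvgZl_tmp; exact: cvg_succ.
apply/funext => n; rewrite /egf_partial /series/= [in RHS]big_nat_recl//= !scaler0 add0r.
rewrite -big_split/= !scaler_sumr; apply: eq_bigr => k _.
rewrite -scalerDr !scalerA -{2}[A _]scale1r -scalerDl !scalerA; congr (_ *: _).
have k1 : k.+1%:R + alpha != 0 by rewrite gt_eqF// addr_gt0.
have k2 : k.+1%:R != 0 :> R by rewrite pnatr_eq0.
have k3 : k`!%:R != 0 :> R by rewrite pnatr_eq0 -lt0n fact_gt0.
rewrite /damping_ratio /exp_coeff/= exprS factS natrM.
move: k1 k2 k3; move: (k.+1%:R) (k`!%:R) => a b k1 k2 k3.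
by field; rewrite k1 k2 k3.
Qed.

Lemma hb_series_solution (F : H -> R) :
  (forall x, is_gradient dot F x (A x)) ->
  heavy_ball_solution dot alpha F (egf hb_coeff).
Proof.
move=> FA.
have d1 t := is_derive_egf _ _ t hb_coeff_bounded.
have d2 t := is_derive_egf _ _ t (fun n => hb_coeff_bounded n.+1).
exists (egf (fun n => hb_coeff n.+1)), (egf (fun n => hb_coeff n.+2)); split.
- split=> [t _||]; first exact: d1.
    (* The series is differentiable on the whole line, so the one-sided derivative at 0 restricts
       the two-sided one. *)
    have [/cvg_ex[l dl] dv] := d1 0.
    have ll : l = egf (fun n => hb_coeff n.+1) 0.
      by rewrite -dv; apply/esym/(cvg_lim (@norm_hausdorff _ _)).
    rewrite -ll; apply: cvg_dnbhs_at_right.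
    rewrite (_ : (fun h => _) = fun h : R =>
        h^-1 *: (egf hb_coeff (h *: 1 + 0) - egf hb_coeff 0))//.
    by apply/funext => h; rewrite addr0 [h *: 1]mulr1.
  apply: continuous_subspaceT.
  exact: (continuous_egf _ _ (fun n => hb_coeff_bounded n.+1)).
- split=> [t _|t _]; first exact: d2.
  exact: (continuous_egf _ _ (fun n => hb_coeff_bounded n.+2)).
- by rewrite egf0.
- by move=> t t0; exists (A (egf hb_coeff t)); split => //; exact: hb_series_ode.
Qed.

(* The terms of order [n >= 2] of the coordinate series are at most
   [2 ^- n * dot u0 v] in absolute value, and those add up to half of [dot u0 v]. *)
Lemma hb_series_coord_ge (v : H) (sigma t : R) :
  (forall x, dot (A x) v = sigma ^+ 2 * dot x v) ->
  0 <= sigma -> 0 <= t -> sigma * t <= 1 / 2 -> 0 <= dot u0 v ->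
  dot u0 v / 2 <= dot (egf hb_coeff t) v.
Proof.
move=> Av sigma0 t0 st b0; set b := dot u0 v.
have coord_le n : `|dot (hb_coeff n) v| <= sigma ^+ n * b.
  suff: `|dot (hb_coeff n) v| <= sigma ^+ n * b /\
      `|dot (hb_coeff n.+1) v| <= sigma ^+ n.+1 * b by case.
  elim: n => [|n [IHn IHn1]].
    rewrite /= expr0 mul1r ger0_norm//; split=> //.
    by rewrite -(scale0r (0 : H)) dotZl mul0r normr0 mulr_ge0// exprn_ge0.
  split=> //; rewrite hb_coeffSS dotZl Av normrM normrN.
  have /andP[c0 c1] := damping_ratio_itv n; rewrite (ger0_norm c0).
  rewrite (le_trans (ler_piMl (normr_ge0 _) c1))// normrM ger0_norm ?sqr_ge0//.
  by rewrite -[n.+2]/(2 + n)%N exprD -mulrA ler_wpM2l// sqr_ge0.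
have h : (fun n => dot (egf_partial hb_coeff t n) v) @ \oo -->
    dot (egf hb_coeff t) v.
  by apply: cvg_dotl => //; exact: cvg_egf _ _ t hb_coeff_bounded.
(* Shifting twice lets the induction start from the partial sum of the terms of order 0 and 1. *)
have {}h := cvg_succ _ _ (cvg_succ _ _ h); apply: (ler_cvg_to (cvg_cst _) h).
apply: nearW => n.
(* The extra [(1 / 2) ^+ n.+1] is what the remaining terms may still subtract; it makes the bound
   inductive and equals 1/2 at [n = 0]. *)
apply: (@le_trans _ _ (b * (1 / 2 + (1 / 2) ^+ n.+1))).
  by rewrite mulrDr mul1r lerDl mulr_ge0// exprn_ge0.
rewrite /egf_partial /series/= dot_suml; elim: n => [|n IHn].
  rewrite !big_nat_recr//= big_nil add0r !dotZl /exp_coeff/=.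
  rewrite -[X in _ <= _ + _ * X](_ : 0 = _); last first.
    by rewrite -(scale0r (0 : H)) dotZl mul0r.
  by rewrite expr0 expr1 divr1 mulr0 addr0 mul1r -/b; lra.
rewrite big_nat_recr//= -[leLHS](subrK (b * (1 / 2) ^+ n.+2)) dotZl.
have term_le : `|exp_coeff t n.+2 * dot (hb_coeff n.+2) v| <= b * (1 / 2) ^+ n.+2.
  rewrite normrM ger0_norm ?exp_coeff_ge0//.
  apply: le_trans (ler_wpM2l (exp_coeff_ge0 _ t0) (coord_le _)) _.
  rewrite mulrCA mulrA mulrC ler_wpM2l// /exp_coeff/= mulrA -exprMn.
  rewrite ler_pdivrMr ?ltr0n ?fact_gt0//.
  apply: (@le_trans _ _ ((1 / 2) ^+ n.+2)).
    by rewrite ler_pXn2r// nnegrE ?mulr_ge0.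
  by rewrite ler_peMr ?exprn_ge0// ler1n fact_gt0.
have := ler_norm (- (exp_coeff t n.+2 * dot (hb_coeff n.+2) v)).
rewrite normrN => nt; move: IHn nt term_le.
rewrite [(1 / 2) ^+ n.+2]exprS.
set p := _ ^+ n.+1; set S := \sum_(_ <= _ < _) _; set q := exp_coeff _ _ * _.
by move=> IHn nt tl; lra.
Qed.

End HeavyBallSeries.

(** * The bundled operator, dyadic brackets, and the choice of initial data *)

Lemma exists_diagonal_operator (R : realType) (H : completeNormedModType R)
    (dot : {dot H for idfun}) (e : nat -> H) (lam : nat -> R) :
  norm_from_dot dot -> orthonormal_seq dot e -> (forall k, 0 < lam k <= 1) ->
  exists A : {linear H -> H},
    [/\ forall x y, dot (A x) y = dot x (A y),
        forall x, `|A x| <= `|x|,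
        forall x, x != 0 -> 0 < dot (A x) x,
        forall x k, dot (A x) (e k) = lam k * dot x (e k) &
        forall x k, lam k * dot x (e k) ^+ 2 <= dot (A x) x].
Proof.
move=> dotE eE lam01.
pose A : {linear H -> H} := HB.pack (@diag_op R H dot e lam)
  (GRing.isLinear.Build R H H *:%R (@diag_op R H dot e lam)
     (diag_op_linear dotE e eE lam lam01)).
exists A; split=> *.
- exact: diag_op_sym.
- exact: diag_op_contract.
- exact: diag_op_form_gt0.
- exact: diag_op_coord.
- exact: diag_op_form_ge.
Qed.

Lemma dyadic_bracket (R : realType) (t : R) :
  1 <= t -> exists k, 2 ^+ k <= t <= 2 ^+ k.+1.
Proof.
move=> t1; have t0 : 0 <= t by lra.
have [n tn] : exists n, t < 2 ^+ n.
  exists (Num.truncn t).+1; apply: lt_trans (truncnS_gt t) _.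
  by rewrite -natrX ltr_nat ltn_expl.
(* Lowering the exponent of an upper bound stops at the first power not exceeding [t]. *)
elim: n tn => [|n IHn] tn; first by move: tn; rewrite expr0; lra.
have [le_n|lt_n] := leP (2 ^+ n) t; first by exists n; rewrite le_n ltW.
exact: IHn.
Qed.

Theorem lemma4p2 (R : realType) (alpha : R) (alpha_gt0 : 0 < alpha)
    (H : completeNormedModType R) (dot : {dot H for idfun})
    (dotE : norm_from_dot dot)
    (Hsep : separable_space H) (Hinf : ~ finite_dimensional H) :
  exists F : H -> R,
    [/\ continuous F,
        strictly_convex F,
        quadratic_function F,
        forall x : H, 0 <= F x &
        forall x : H, F x = 0 <-> x = 0] /\
    forall g : R -> R,
      (forall t : R, 0 < t -> 0 < g t) ->
      (forall s t : R, 0 < s -> s <= t -> g t <= g s) ->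
      (\int[lebesgue_measure]_(t in (`]0%R, +oo[%classic : set R)) (t * g t)%:E < +oo)%E ->
      exists u : R -> H,
        heavy_ball_solution dot alpha F u /\
        forall t : R, 1 <= t -> g t <= F (u t).
Proof.
have [e eE] : exists e, orthonormal_seq dot e by exact: exists_orthonormal_seq.
(* Chosen so that [sigma k * 2 ^+ k.+1 = 1 / 2]: the coordinate bound then holds up to the end of
   the bracket of [k]. The choice precedes [g], so the energy does not depend on it. *)
pose sigma k : R := (1 / 2) ^+ k.+2.
have sigma0 k : 0 < sigma k by rewrite exprn_gt0//; lra.
have lam01 k : 0 < sigma k ^+ 2 <= 1.
  rewrite exprn_gt0//= expr_le1//; last exact: ltW.
  by rewrite expr_le1//; lra.
have [A [Asym Acon Agt0 Ae Aform]] := exists_diagonal_operator _ _ _ _ _ dotE eE lam01.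
exists (@energy R H dot A); split.
  split.
  - exact: energy_continuous.
  - exact: energy_strictly_convex.
  - exact: energy_quadratic.
  - exact: energy_ge0.
  - exact: energy_eq0.
move=> g g_gt0 g_decr g_int.
have [M gM] := dyadic_sum_bounded g g_gt0 g_decr g_int.
(* The constant solves [sigma k ^+ 2 * (a k / 2) ^+ 2 / 2 = g (2 ^+ k)], where
   [sigma k ^+ 2 = (16 * 4 ^+ k)^-1]. *)
pose a k : R := Num.sqrt (128 * 4 ^+ k * g (2 ^+ k)).
have a2 k : a k ^+ 2 = 128 * 4 ^+ k * g (2 ^+ k).
  by rewrite sqr_sqrtr// !mulr_ge0 ?exprn_ge0// ltW// g_gt0// exprn_gt0.
have a_cvg : cvgn (series (fun k => a k *: e k)).
  apply: (l2_cvg_series dotE _ eE _ (128 * M)) => n.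
  rewrite (eq_bigr (fun k => 128 * (4 ^+ k * g (2 ^+ k)))) -?mulr_sumr ?ler_wpM2l//.
  by move=> k _; rewrite a2 mulrA.
pose u0 : H := limn (series (fun k => a k *: e k)).
have u0e k : dot u0 (e k) = a k by exact: (dot_series_coord dotE _ eE).
exists (egf (hb_coeff A alpha u0)); split.
  by apply: hb_series_solution => // x; exact: energy_gradient.
move=> t t1; have [k /andP[kt tk]] := dyadic_bracket _ _ t1.
(* On the whole bracket [g] is at most its value at the left end, so one coordinate of [u t] has to
   reach only that value. *)
apply: (@le_trans _ _ (g (2 ^+ k))); first by rewrite g_decr// exprn_gt0.
set x := egf _ _.
have xe : a k / 2 <= dot x (e k).
  rewrite -u0e; apply: (hb_series_coord_ge dotE A Acon _ alpha_gt0 _ _ (sigma k)).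
  - by move=> y; rewrite Ae.
  - exact: ltW.
  - by lra.
  - apply: (le_trans (ler_wpM2l (ltW (sigma0 k)) tk)).
    rewrite /sigma [(1 / 2) ^+ k.+2]exprS -[leLHS]mulrA -exprMn.
    by rewrite (_ : 1 / 2 * 2 = 1) ?expr1n ?mulr1//; field.
  - by rewrite u0e sqrtr_ge0.
rewrite /energy ler_pdivlMr//; apply: le_trans (Aform x k).
have : (a k / 2) ^+ 2 <= dot x (e k) ^+ 2.
  by rewrite lerXn2r// nnegrE ?(le_trans _ xe)// divr_ge0// sqrtr_ge0.
move=> /(ler_wpM2l (sqr_ge0 (sigma k))); apply: le_trans.
rewrite expr_div_n a2 /sigma -exprM.
have p0 : 4 ^+ k != 0 :> R by rewrite expf_neq0.
have -> : (1 / 2) ^+ (k.+2 * 2) = (16 * 4 ^+ k)^-1 :> R.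
  rewrite mulnC exprM !exprS mulrA invfM -exprVn.
  by congr (_ * _ ^+ _); field.
(* By the choice of 128 both sides coincide. *)
rewrite le_eqVlt; apply/orP; left; apply/eqP; field; exact: p0.
Qed.
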